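(* Let $H_1, H_2$ be graphs. The class of $\{H_1, H_2\}$-free graphs is bounded-apex-interval if and only if, up to switching the labels of $H_1$ and $H_2$, one of the following holds: 1. $H_1$ is an induced subgraph of $P_3$; 2. $H_1$ is an induced subgraph of $P_4$ and $H_2 \cong C_4$, in which case one can take $c=0$ (that is, every $\{H_1,H_2\}$-free graph is an interval graph); or 3. $H_1$ is a complete graph and $H_2$ is edgeless.
   Context: All graphs are finite and simple. $C_r$, $P_r$ denote the cycle and path on $r$ vertices. ''Induced subgraph of $X$'' means isomorphic to $X[S]$ for some $S\subseteq V(X)$. For a set $\mathcal{H}$ of graphs, a graph is $\mathcal{H}$-free if none of its induced subgraphs is isomorphic to a graph in $\mathcal{H}$. An interval graph is the intersection graph of a finite set of intervals of $\mathbb{R}$. For $c\in\mathbb{N}$ (with $c=0$ allowed), a class of graphs is $c$-apex-interval if every graph $G$ in the class has a set $S\subseteq V(G)$ with $|S|\le c$ such that $G-S$ is an interval graph; the class is bounded-apex-interval if it is $c$-apex-interval for some constant $c$. *)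

(* Defs.v *)
From HB Require Import structures.
From mathcomp Require Import all_boot all_order all_algebra.
From mathcomp Require Import boolp classical_sets reals num_normedtype.

Set Implicit Arguments.
Unset Strict Implicit.
Unset Printing Implicit Defensive.

Record sgraph := SGraph {
  vertex :> finType;
  edge : rel vertex;
  edge_sym : symmetric edge;
  edge_irrefl : irreflexive edge }.

Definition isomorphic (G H : sgraph) : Prop :=
  exists2 f : G -> H, bijective f & forall x y, edge (f x) (f y) = edge x y.

Section InducedGraph.
Variables (G : sgraph) (S : {set G}).

Definition induced_edge : rel {x : G | x \in S} :=
  fun x y => edge (val x) (val y).

Lemma induced_edge_sym : symmetric induced_edge.
Proof. by move=> x y; exact: edge_sym. Qed.

Lemma induced_edge_irrefl : irreflexive induced_edge.
Proof. by move=> x; exact: edge_irrefl. Qed.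

Definition induced : sgraph := SGraph induced_edge_sym induced_edge_irrefl.
End InducedGraph.

Definition induced_subgraph (H G : sgraph) : Prop :=
  exists S : {set G}, isomorphic H (induced S).

Definition delete_vertices (G : sgraph) (S : {set G}) : sgraph :=
  induced (~: S).

Section PathsAndCycles.
Variable n : nat.

Definition path_edge : rel 'I_n :=
  fun i j => (i.+1 == j :> nat) || (j.+1 == i :> nat).

Lemma path_edge_sym : symmetric path_edge.
Proof. by move=> i j; rewrite /path_edge orbC. Qed.

Lemma path_edge_irrefl : irreflexive path_edge.
Proof. by move=> i; rewrite /path_edge orbb gtn_eqF. Qed.

Definition path_graph : sgraph := SGraph path_edge_sym path_edge_irrefl.

(* This is the cycle C_n only when 3 <= n. *)
Definition cycle_edge : rel 'I_n :=
  fun i j => (i != j) && ((i.+1 %% n == j) || (j.+1 %% n == i)).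

Lemma cycle_edge_sym : symmetric cycle_edge.
Proof. by move=> i j; rewrite /cycle_edge eq_sym orbC. Qed.

Lemma cycle_edge_irrefl : irreflexive cycle_edge.
Proof. by move=> i; rewrite /cycle_edge eqxx. Qed.

Definition cycle_graph : sgraph := SGraph cycle_edge_sym cycle_edge_irrefl.
End PathsAndCycles.

Definition complete_graph (G : sgraph) : Prop :=
  forall x y : G, x != y -> edge x y.

Definition edgeless_graph (G : sgraph) : Prop :=
  forall x y : G, ~~ edge x y.

(* [set sgraph] would be a universe inconsistency, since the library uses [set]
   on types small enough to be the carrier of a [finType]. *)
Definition graph_class : Type := sgraph -> Prop.

Definition graph_pair (H1 H2 : sgraph) : graph_class :=
  fun H => H = H1 \/ H = H2.

Definition free_of (HH : graph_class) : graph_class :=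
  fun G => forall (S : {set G}) (H : sgraph),
    HH H -> ~ isomorphic (induced S) H.

(* The vertices of the intersection graph of a *set* of intervals are the
   intervals themselves, so the vertex labelling [I] is injective. *)
Definition interval_graph (R : realType) (G : sgraph) : Prop :=
  exists I : G -> set R,
    [/\ injective I, forall x, is_interval (I x) &
        forall x y, edge x y <-> x != y /\ (I x `&` I y !=set0)%classic].

Definition apex_interval (R : realType) (c : nat) (C : graph_class) : Prop :=
  forall G, C G ->
    exists2 S : {set G}, #|S| <= c & interval_graph R (delete_vertices S).

Definition bounded_apex_interval (R : realType) (C : graph_class) : Prop :=
  exists c, apex_interval R c C.

(* Main.v *)
Require Import Defs.
From mathcomp Require Import all_boot all_order all_algebra.
From mathcomp Require Import boolp classical_sets reals num_normedtype.

(** Sufficiency.  An induced subgraph of P_3 is one of P_4 and of C_4, so the first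
two cases reduce to one fact: a graph without induced P_4 and C_4 is an interval
graph.  In such a graph a vertex of maximum degree, together with its
neighbours, forms a whole connected component.  Give it an interval covering
those of its neighbours, represent the neighbourhood and the rest recursively,
and place the two representations side by side ([quasi_threshold_bounds]).  In
the third case Ramsey's theorem bounds the number of vertices, and deleting all
of them leaves the empty graph.

Necessity.  A graph F made of many interchangeable rows, three of which already
do not form an interval graph, stays non-interval after the deletion of any
bounded number of vertices ([rows_far]); so a bounded class omits F, that is, H1
or H2 embeds in F.  Three rows fail to be interval because they contain an induced
C_4, an induced C_5 or an asteroidal triple, which are incompatible with the
relation of lying entirely to the left, under which two non-adjacent vertices
are always comparable ([interval_precedence]).  Six such families suffice:
- disjoint 6-cycles, which are bipartite and have no induced C_4 and no claw;
- complete bipartite graphs, and cocktail party graphs K_{2,...,2}, which have no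
  induced K_2 + K_1, the former being bipartite and the latter having no three
  independent vertices;
- prisms over cliques, with no three independent vertices and no diamond;
- clique blow-ups of C_5, with no three independent vertices and no induced C_4;
- thick spiders (split graphs), with no induced C_4 and no induced 2K_2.

Let A be the one of H1, H2 that embeds in disjoint 6-cycles, and B the other.
If A has three independent vertices, then B embeds in a cocktail party graph and
in a prism, hence is complete, contained in P_3, or C_4 ([complete_P3_or_C4]).
The blow-ups of C_5 rule out C_4, and when B is complete the complete bipartite
graphs force B to lie in P_3 or A to be edgeless ([claw_free_edgeless]).  If A has
no three independent vertices and no induced K_2 + K_1, then A lies in P_3.
Otherwise A contains K_2 + K_1, so B embeds in a complete bipartite graph and in
a cocktail party graph, hence lies in P_3 or is C_4; in the latter case A embeds
in a thick spider and therefore lies in P_4 ([embeds_P4]). *)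

Set Implicit Arguments.
Unset Strict Implicit.
Unset Printing Implicit Defensive.

Implicit Types G H K A B : sgraph.

(** * Embeddings *)

(** An injection preserving adjacency both ways composes and transfers universal
properties more conveniently than an isomorphism onto an induced subgraph. *)
Definition embeds (H G : sgraph) : Prop :=
  exists2 f : H -> G, injective f & forall x y, edge (f x) (f y) = edge x y.

Lemma embeds_refl G : embeds G G.
Proof. by exists id. Qed.

Lemma embeds_trans G H K : embeds H G -> embeds G K -> embeds H K.
Proof.
case=> f fI fE [g gI gE]; exists (g \o f); first exact: inj_comp.
by move=> x y; rewrite /= gE fE.
Qed.

Lemma isomorphic_sym G H : isomorphic G H -> isomorphic H G.
Proof.
case=> f [g fK gK] fE; exists g; first by exists f.
by move=> x y; rewrite -fE !gK.
Qed.

Lemma isomorphic_embeds G H : isomorphic G H -> embeds G H.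
Proof. by case=> f /bij_inj fI fE; exists f. Qed.

Lemma embeds_isomorphic H G : embeds H G -> #|G| <= #|H| -> isomorphic H G.
Proof. by case=> f fI fE le; exists f => //; apply: inj_card_bij. Qed.

Lemma induced_embeds G (S : {set G}) : embeds (induced S) G.
Proof. by exists val => //; exact: val_inj. Qed.

Lemma induced_subgraphE H G : induced_subgraph H G <-> embeds H G.
Proof.
split=> [[S /isomorphic_embeds HS]|[f fI fE]].
  exact: embeds_trans HS (induced_embeds S).
have fS x : f x \in f @: [set: H] by rewrite imset_f.
exists (f @: [set: H]); apply: embeds_isomorphic.
  by exists (fun x => exist _ (f x) (fS x)) => // x y [/fI].
by rewrite card_sig card_imset // cardsT.
Qed.

Lemma free_pairE A B G :
  free_of (graph_pair A B) G <-> ~ embeds A G /\ ~ embeds B G.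
Proof.
split=> [GF|[nA nB] S H [->|->] /isomorphic_sym/isomorphic_embeds HS].
- by split=> /induced_subgraphE[S /isomorphic_sym];
    apply: GF; [left|right].
- exact/nA/(embeds_trans HS)/induced_embeds.
- exact/nB/(embeds_trans HS)/induced_embeds.
Qed.

(** * Interval graphs *)

Section Interval.
Import Order.TTheory GRing.Theory Num.Theory.
Variable R : realType.

Lemma interval_embeds G H :
  embeds H G -> interval_graph R G -> interval_graph R H.
Proof.
case=> f fI fE [I [II Iint IE]]; exists (I \o f); split=> //.
- exact: inj_comp.
- by move=> x; exact: Iint.
- by move=> x y; rewrite -fE IE (inj_eq fI).
Qed.

(** Distinct vertices must receive distinct intervals, although the bounds [l] and
[r] may coincide.  Scaling by the number of vertices leaves room to shift each
right end by the rank of the vertex, less than one unit, which changes no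
intersection but separates the intervals. *)
Lemma interval_of_nat_bounds G (l r : G -> nat) :
  (forall x, l x <= r x) ->
  (forall x y, x != y -> edge x y = (l x <= r y) && (l y <= r x)) ->
  interval_graph R G.
Proof.
move=> lr lrE.
pose a x := l x * #|G|; pose b x := r x * #|G| + enum_rank x.
have abE x y : (a x <= b y) = (l x <= r y).
  apply/idP/idP => h; last first.
    by apply: leq_trans (leq_addr _ _); rewrite leq_mul2r h orbT.
  rewrite leqNgt; apply/negP => h'; move: h; apply/negP; rewrite -ltnNge /b.
  by apply: leq_trans (leq_mul h' (leqnn _)); rewrite mulSnr ltn_add2l.
have ab x : a x <= b x by rewrite abE.
pose J x := [set z : R | ((a x)%:R <= z <= (b x)%:R)%R]%classic.
have le_b x y : J x = J y -> b x <= b y.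
  move=> xy; have : J x (b x)%:R%R by rewrite /J /= lexx ler_nat ab.
  by rewrite xy /J /= !ler_nat => /andP[].
exists J; split.
- move=> x y xy.
  have : b x = b y by apply/eqP; rewrite eqn_leq !le_b.
  move=> /(congr1 (modn^~ #|G|)).
  rewrite /b !modnMDl !modn_small ?ltn_ord // => /val_inj.
  exact: enum_rank_inj.
- move=> x p q /= /andP[ap _] /andP[_ qb] z /andP[pz zq].
  by rewrite /J /= (le_trans ap pz) (le_trans zq qb).
- move=> x y; split=> [xy|[xy]].
    have nxy : x != y by apply: contraTneq xy => ->; rewrite edge_irrefl.
    split=> //; move: xy; rewrite (lrE _ _ nxy) => /andP[lxy lyx].
    exists (maxn (a x) (a y))%:R%R => /=.
    by rewrite /J /= !ler_nat !geq_max !leq_max !leqnn !abE !lr lxy lyx orbT.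
  case=> z [/andP[axz zbx] /andP[ayz zby]].
  rewrite (lrE _ _ xy) -!abE -!(ler_nat R).
  by rewrite (le_trans axz zby) (le_trans ayz zbx).
Qed.

Lemma interval_no_vertices G : #|G| = 0 -> interval_graph R G.
Proof.
move=> G0; have nG (x : G) : False by have := fintype0 x G0.
by apply: (@interval_of_nat_bounds _ (fun=> 0) (fun=> 0)) => // x; case: (nG x).
Qed.

(** [P x y] says that the interval of [x] lies entirely to the left of that of
[y].  The third clause is the (2+2)-freeness of interval orders.  An empty
interval precedes itself and breaks transitivity; the fourth clause avoids this
by asking the middle vertex to have a neighbour. *)
Lemma interval_precedence G : interval_graph R G ->
  exists P : G -> G -> Prop,
    [/\ forall x y, P x y -> ~~ edge x y,
        forall x y, x != y -> ~~ edge x y -> P x y \/ P y x,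
        forall x y z w, P x y -> P z w -> P x w \/ P z y &
        forall x y z w, P x y -> P y z -> edge y w -> P x z].
Proof.
case=> I [_ Iint IE].
pose P x y := forall p q, I x p -> I y q -> (p < q)%R.
have PnE x y : P x y -> ~~ edge x y.
  by move=> Pxy; apply/negP => /IE[_ [p [xp yp]]]; have := Pxy p p xp yp; rewrite ltxx.
have Pswap x y z w : P x y -> P z w -> P x w \/ P z y.
  move=> Pxy Pzw; apply: contrapT => /not_orP[nxw nzy].
  apply: nxw => p q xp wq; rewrite ltNge; apply/negP => qp.
  apply: nzy => r s zr ys.
  by apply: (lt_trans (Pzw _ _ zr wq)); apply: (le_lt_trans qp); exact: Pxy.
exists P; split=> //.
- move=> x y xy nxy; apply: contrapT => /not_orP[nPxy nPyx].
  have disj z : I x z -> I y z -> False.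
    by move=> xz yz; move/negP: nxy; apply; apply/IE; split=> //; exists z.
  apply: nPxy => p q xp yq; rewrite ltNge; apply/negP => qp.
  apply: nPyx => q' p' yq' xp'; rewrite ltNge; apply/negP => pq'.
  case: (leP p' q) => [pq|/ltW qp'].
    by apply: (disj q) => //; apply: (Iint x p' p) => //; rewrite pq qp.
  by apply: (disj p') => //; apply: (Iint y q q') => //; rewrite qp' pq'.
- move=> x y z w Pxy Pyz yw; case: (Pswap _ _ _ _ Pxy Pyz) => // Pyy.
  by case/IE: yw => _ [p [yp _]]; have := Pyy p p yp yp; rewrite ltxx.
Qed.

End Interval.
(** * Forbidden configurations *)

Definition bipartite G : Prop :=
  exists p : G -> bool, forall x y, edge x y -> p x != p y.

(** Excludes K_2 + K_1, the complement of P_3: non-adjacency is then transitive,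
so these are the complete multipartite graphs. *)
Definition coP3_free G : Prop :=
  forall x y z : G, edge x y -> edge x z || edge y z.

Definition co_triangle_free G : Prop :=
  forall x y z : G, x != y -> y != z -> x != z ->
  [|| edge x y, edge y z | edge x z].

(** The diamond is K_4 minus the edge between [a] and [b]. *)
Definition diamond_free G : Prop :=
  forall a b c d : G, edge a c -> edge a d -> edge b c -> edge b d ->
  edge c d -> a != b -> edge a b.

Definition claw_free G : Prop :=
  forall c x y z : G, edge c x -> edge c y -> edge c z ->
  x != y -> y != z -> x != z -> [|| edge x y, edge y z | edge x z].

(** The hypotheses force the four vertices to be distinct. *)
Definition C4_free G : Prop :=
  forall a b c d : G, edge a b -> edge b c -> edge c d -> edge d a ->
  a != c -> b != d -> edge a c || edge b d.

(** The edges may share ends: the conclusion is then immediate, since a shared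
end is adjacent to the other end of each edge. *)
Definition two_K2_free G : Prop :=
  forall a b c d : G, edge a b -> edge c d ->
  [|| edge a c, edge a d, edge b c | edge b d].

Section Hereditary.
Variables (H G : sgraph) (HG : embeds H G).

Lemma bipartite_embeds : bipartite G -> bipartite H.
Proof.
case: HG => f _ fE [p pE]; exists (p \o f) => x y.
by rewrite -fE; exact: pE.
Qed.

Lemma coP3_free_embeds : coP3_free G -> coP3_free H.
Proof. by case: HG => f _ fE h x y z; rewrite -!fE; exact: h. Qed.

Lemma co_triangle_free_embeds : co_triangle_free G -> co_triangle_free H.
Proof.
by case: HG => f fI fE h x y z; rewrite -!fE -!(inj_eq fI); exact: h.
Qed.

Lemma diamond_free_embeds : diamond_free G -> diamond_free H.
Proof.
by case: HG => f fI fE h a b c d; rewrite -!fE -!(inj_eq fI); exact: h.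
Qed.

Lemma claw_free_embeds : claw_free G -> claw_free H.
Proof.
by case: HG => f fI fE h a b c d; rewrite -!fE -!(inj_eq fI); exact: h.
Qed.

Lemma C4_free_embeds : C4_free G -> C4_free H.
Proof.
by case: HG => f fI fE h a b c d; rewrite -!fE -!(inj_eq fI); exact: h.
Qed.

Lemma two_K2_free_embeds : two_K2_free G -> two_K2_free H.
Proof. by case: HG => f _ fE h a b c d; rewrite -!fE; exact: h. Qed.

End Hereditary.

Lemma edge_neq G (x y : G) : edge x y -> x != y.
Proof. by apply: contraTneq => ->; rewrite edge_irrefl. Qed.

Lemma bipartite_no_triangle G (x y z : G) :
  bipartite G -> edge x y -> edge y z -> ~~ edge x z.
Proof.
case=> p pE /pE xy /pE yz; apply/negP => /pE.
by move: xy yz; case: (p x); case: (p y); case: (p z).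
Qed.

Lemma bipartite_diamond_free G : bipartite G -> diamond_free G.
Proof.
move=> Gb a b c d ac ad bc bd cd _.
by have := bipartite_no_triangle Gb ac cd; rewrite ad.
Qed.

(** * Embeddings of small paths and cycles *)

Lemma P4_embeds G (a b c d : G) : edge a b -> edge b c -> edge c d ->
  ~~ edge a c -> ~~ edge b d -> ~~ edge a d -> a != c -> b != d ->
  embeds (path_graph 4) G.
Proof.
move=> ab bc cd ac bd ad nac nbd.
have nad : a != d by apply: contraNneq ac => ->; rewrite edge_sym.
have := (edge_neq ab, edge_neq bc, edge_neq cd).
move=> [[nab nbc] ncd].
exists (fun i : 'I_4 => nth a [:: a; b; c; d] i).
  move=> [i Hi] [j Hj] /= /eqP; rewrite (nth_uniq a) //=.
    by move=> /eqP ij; apply: val_inj.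
  by rewrite !inE !negb_or nab nac nad nbc nbd ncd.
have E := (edge_irrefl, ab, bc, cd, negbTE ac, negbTE bd, negbTE ad).
by move=> [[|[|[|[|//]]]] ?] [[|[|[|[|//]]]] ?] /=;
  rewrite ?E // edge_sym E.
Qed.

Lemma C4_embeds G (a b c d : G) : edge a b -> edge b c -> edge c d ->
  edge d a -> ~~ edge a c -> ~~ edge b d -> a != c -> b != d ->
  embeds (cycle_graph 4) G.
Proof.
move=> ab bc cd da ac bd nac nbd.
have := (edge_neq ab, edge_neq bc, edge_neq cd, edge_neq da).
move=> [[[nab nbc] ncd]]; rewrite eq_sym => nad.
exists (fun i : 'I_4 => nth a [:: a; b; c; d] i).
  move=> [i Hi] [j Hj] /= /eqP; rewrite (nth_uniq a) //=.
    by move=> /eqP ij; apply: val_inj.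
  by rewrite !inE !negb_or nab nac nad nbc nbd ncd.
have E := (edge_irrefl, ab, bc, cd, da, negbTE ac, negbTE bd).
by move=> [[|[|[|[|//]]]] ?] [[|[|[|[|//]]]] ?] /=;
  rewrite ?E // edge_sym E.
Qed.

Lemma cycle4_not_C4_free : ~ C4_free (cycle_graph 4).
Proof.
move=> h.
have := h (@Ordinal 4 0 isT) (@Ordinal 4 1 isT) (@Ordinal 4 2 isT)
  (@Ordinal 4 3 isT).
by move=> /(_ isT isT isT isT isT isT).
Qed.

Lemma P3_embeds_P4 : embeds (path_graph 3) (path_graph 4).
Proof.
exists (widen_ord (leqnSn 3)) => [x y /(congr1 val) /= xy|//].
exact: val_inj.
Qed.

Lemma P3_embeds_C4 : embeds (path_graph 3) (cycle_graph 4).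
Proof.
exists (widen_ord (leqnSn 3)) => [x y /(congr1 val) /= xy|].
  exact: val_inj.
by move=> [[|[|[|//]]] ?] [[|[|[|//]]] ?].
Qed.

(** * Obstructions to being an interval graph *)

Section Obstructions.
Variable R : realType.

(** The two non-adjacent pairs of a C_4 are both comparable, and form a 2+2 in the
precedence order, whichever way they are oriented. *)
Lemma interval_C4_free G : interval_graph R G -> C4_free G.
Proof.
move=> /interval_precedence[P [PnE Ptot Pswap _]] a b c d ab bc cd da ac bd.
apply: contraT; rewrite negb_or => /andP[nac nbd].
have key x y z w : edge x w -> edge z y -> P x y -> P z w -> False.
  move=> xw zy Pxy Pzw; case: (Pswap _ _ _ _ Pxy Pzw) => /PnE.
    by rewrite xw.
  by rewrite zy.
case: (Ptot _ _ ac nac) => Pac; case: (Ptot _ _ bd nbd) => Pbd.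
- by case: (key a c b d) => //; rewrite edge_sym.
- by case: (key a c d b) => //; rewrite edge_sym.
- by case: (key c a b d) => //; rewrite edge_sym.
- by case: (key c a d b) => //; rewrite edge_sym.
Qed.

(** The precedence would orient the complement of C_5, again a 5-cycle.  An odd
cycle cannot be oriented with sources and sinks alternating, so two consecutive
arcs compose, and transitivity makes two adjacent vertices comparable. *)
Lemma interval_no_C5 : ~ interval_graph R (cycle_graph 5).
Proof.
move=> /interval_precedence[P [PnE Ptot _ Ptr]].
pose o i (h : i < 5) : cycle_graph 5 := Ordinal h.
pose v0 := @o 0 isT; pose v1 := @o 1 isT; pose v2 := @o 2 isT.
pose v3 := @o 3 isT; pose v4 := @o 4 isT.
have key x y z w : P x y -> P y z -> edge y w -> edge x z -> False.
  by move=> Pxy Pyz yw xz; have := PnE _ _ (Ptr _ _ _ _ Pxy Pyz yw); rewrite xz.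
(* Walk around the complement 0-2-4-1-3-0: at one of the five vertices both arcs
   agree, in one of the two directions. *)
case: (Ptot v0 v2 isT isT) => P02; case: (Ptot v2 v4 isT isT) => P24;
case: (Ptot v4 v1 isT isT) => P41; case: (Ptot v1 v3 isT isT) => P13;
case: (Ptot v3 v0 isT isT) => P30.
all: first [ by apply: (key v0 v2 v4 v1 P02 P24)
 | by apply: (key v4 v2 v0 v1 P24 P02)
 | by apply: (key v2 v4 v1 v0 P24 P41)
 | by apply: (key v1 v4 v2 v0 P41 P24)
 | by apply: (key v4 v1 v3 v0 P41 P13)
 | by apply: (key v3 v1 v4 v0 P13 P41)
 | by apply: (key v1 v3 v0 v2 P13 P30)
 | by apply: (key v0 v3 v1 v2 P30 P13)
 | by apply: (key v3 v0 v2 v1 P30 P02)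
 | by apply: (key v2 v0 v3 v1 P02 P30) ].
Qed.

(** Of three pairwise comparable vertices one lies in between the other two; the
common neighbour of these two would have to reach across it, while it is
non-adjacent to it and hence lies on one side.  Asteroidal triples joined by
paths of length two are all that 6-cycles and thick spiders require. *)
Lemma interval_no_asteroidal_triple G (x y z u v w : G) :
  x != y -> y != z -> x != z -> ~~ edge x y -> ~~ edge y z -> ~~ edge x z ->
  edge x u -> edge y u -> ~~ edge z u -> z != u ->
  edge y v -> edge z v -> ~~ edge x v -> x != v ->
  edge x w -> edge z w -> ~~ edge y w -> y != w ->
  ~ interval_graph R G.
Proof.
move=> xy yz xz nxy nyz nxz xu yu nzu zu yv zv nxv xv xw zw nyw yw.
move=> /interval_precedence[P [PnE Ptot _ Ptr]].
have key a b c m k : edge b k -> edge a m -> edge c m -> ~~ edge b m ->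
    b != m -> P a b -> P b c -> False.
  move=> bk am cm nbm bm Pab Pbc; case: (Ptot _ _ bm nbm) => Pbm.
    by have := PnE _ _ (Ptr _ _ _ _ Pab Pbm bk); rewrite am.
  by have := PnE _ _ (Ptr _ _ _ _ Pbm Pbc bk); rewrite edge_sym cm.
have kx := key _ x _ _ _ xu _ _ nxv xv.
have ky := key _ y _ _ _ yu _ _ nyw yw.
have kz := key _ z _ _ _ zv _ _ nzu zu.
case: (Ptot _ _ xy nxy) => Pxy; case: (Ptot _ _ yz nyz) => Pyz;
  case: (Ptot _ _ xz nxz) => Pxz; by eauto.
Qed.

End Obstructions.

(** * Graphs determined by excluded configurations *)

(** In a complete multipartite graph with parts of size at most two, a
non-adjacent pair [a], [b] is joined to all other vertices.  Without a diamond
these are pairwise non-adjacent, so there are at most two of them. *)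
Lemma complete_P3_or_C4 H :
  coP3_free H -> co_triangle_free H -> diamond_free H ->
  [\/ complete_graph H, embeds H (path_graph 3) |
      isomorphic H (cycle_graph 4)].
Proof.
move=> Hm Ht Hd.
have [[a [b [ab nab]]]|none] := EM (exists a b : H, a != b /\ ~~ edge a b);
  last first.
  apply: Or31 => x y xy; apply: contrapT => /negP nxy.
  by apply: none; exists x, y.
have other x : x != a -> x != b -> edge a x /\ edge b x.
  rewrite ![x == _]eq_sym => ax bx.
  have := Ht a b x ab bx ax; rewrite (negbTE nab) /= => /orP[bEx|aEx].
    by have := Hm _ _ a bEx; rewrite edge_sym (negbTE nab) /= edge_sym.
  by have := Hm _ _ b aEx; rewrite (negbTE nab) /= edge_sym.
have indep x y : x != a -> x != b -> y != a -> y != b -> ~~ edge x y.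
  move=> xa xb ya yb; apply/negP => xy.
  have [ax bx] := other _ xa xb; have [ay byy] := other _ ya yb.
  by move/negP: nab; apply; exact: (Hd a b x y).
have [[c [d [cd ca cb [da db]]]]|one] :=
  EM (exists c d : H, [/\ c != d, c != a, c != b & d != a /\ d != b]).
  have [ac bc] := other _ ca cb; have [ad bd] := other _ da db.
  have ncd : ~~ edge c d by exact: indep.
  apply: Or33; apply: isomorphic_sym; apply: embeds_isomorphic.
    by apply: (@C4_embeds _ a c b d) => //; rewrite edge_sym.
  rewrite card_ord; apply: (@leq_trans (size [:: a; b; c; d])) => //.
  rewrite -cardsT; apply: leq_trans (card_size _).
  apply/subset_leq_card/fintype.subsetP => x _; apply: contraT.
  rewrite !inE !negb_or => /and4P[xa xb xc xd].
  have dx : d != x by rewrite eq_sym.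
  have cx : c != x by rewrite eq_sym.
  by have := Ht c d x cd dx cx; rewrite (negbTE ncd) !(negbTE (indep _ _ _ _ _ _)).
apply: Or32.
pose g x : nat := if x == a then 0 else if x == b then 2 else 1.
have g3 x : g x < 3 by rewrite /g; do 2!case: ifP => _ //.
have gP x : [\/ x = a /\ g x = 0, x = b /\ g x = 2 |
    (x != a /\ x != b) /\ g x = 1].
  rewrite /g; case: (eqVneq x a) => [|xa]; first by constructor 1.
  by case: (eqVneq x b) => [|xb]; [constructor 2 | constructor 3].
exists (fun x => inord (g x) : path_graph 3) => [x y /(congr1 val)|x y].
  rewrite /= !inordK //.
  case: (gP x) => -[xE ->]; case: (gP y) => -[yE ->] // _; rewrite ?xE ?yE //.
  case: xE yE => xa xb [ya yb]; apply: contrapT => /eqP xy.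
  by apply: one; exists x, y.
have S u v : edge u v = edge v u by exact: edge_sym.
rewrite /= /path_edge !inordK //.
case: (gP x) => -[xE ->]; case: (gP y) => -[yE ->] /=;
  rewrite ?xE ?yE ?edge_irrefl //.
- by rewrite (negbTE nab).
- by case: yE => ya yb; case: (other _ ya yb) => ->.
- by rewrite S (negbTE nab).
- by case: yE => ya yb; case: (other _ ya yb) => _ ->.
- by case: xE => xa xb; rewrite S; case: (other _ xa xb) => ->.
- by case: xE => xa xb; rewrite S; case: (other _ xa xb) => _ ->.
- by case: xE yE => xa xb [ya yb]; rewrite (negbTE (indep _ _ _ _ _ _)).
Qed.

Lemma complete_bipartite_embeds_P3 H :
  complete_graph H -> bipartite H -> embeds H (path_graph 3).
Proof.
move=> Hc [p pE]; pose f x : path_graph 3 := widen_ord (leqnSn 2) (inord (p x)).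
have fE x : f x = p x :> nat by rewrite /= inordK //; case: (p x).
have pN x y : x != y -> p x != p y by move=> /Hc/pE.
exists f => [x y fxy|x y].
  apply: contrapT => /eqP/pN; have := fE x; rewrite fxy fE.
  by case: (p x); case: (p y).
rewrite /= /path_edge !fE; have [->|xy] := eqVneq x y.
  by rewrite edge_irrefl; case: (p y).
by rewrite (Hc _ _ xy); have := pN _ _ xy; case: (p x); case: (p y).
Qed.

(** An independent triple lies in one part of a complete multipartite graph.  One
end of any edge lies outside that part and is the centre of a claw. *)
Lemma claw_free_edgeless H :
  coP3_free H -> claw_free H -> ~ co_triangle_free H -> edgeless_graph H.
Proof.
move=> Hm Hcl nHt a b; apply/negP => ab; apply: nHt => x y z xy yz xz.
apply: contraT; rewrite !negb_or => /and3P[nxy nyz nxz].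
have full c : edge c x -> False.
  move=> cx; have := Hm _ _ y cx; have := Hm _ _ z cx.
  rewrite (negbTE nxy) (negbTE nxz) !orbF => cz cy.
  by have := Hcl c x y z cx cy cz xy yz xz;
    rewrite (negbTE nxy) (negbTE nxz) (negbTE nyz).
by case/orP: (Hm _ _ x ab) => /full.
Qed.

(** Take an edge [ab] and a vertex [c] adjacent to neither end.  Any further
vertex is adjacent to [c], by the absence of independent triples and triangles,
and to one of [a] and [b], by the absence of 2K_2.  Two such vertices would close
a C_4 through [c] if they meet the same end of [ab], and a 5-cycle otherwise. *)
Lemma embeds_P4 H :
  bipartite H -> C4_free H -> two_K2_free H -> co_triangle_free H ->
  ~ coP3_free H -> embeds H (path_graph 4).
Proof.
move=> Hb H4 H2 Ht nHm.
have [a [b [c [ab nac nbc]]]] :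
    exists a b c : H, [/\ edge a b, ~~ edge a c & ~~ edge b c].
  apply: contrapT => no; apply: nHm => a b c ab; apply: contraT.
  by rewrite negb_or => /andP[ac bc]; case: no; exists a, b, c.
have neqc x y : edge x y -> ~~ edge y c -> c != x.
  by move=> xy yc; apply: contraNneq yc => ->; rewrite edge_sym.
have other a' b' d : edge a' b' -> ~~ edge a' c -> ~~ edge b' c ->
    d != a' -> d != b' -> d != c -> edge c d.
  move=> ab' nac' nbc' da db dc; apply: contraT => ncd.
  have cd : c != d by rewrite eq_sym.
  have ba' : edge b' a' by rewrite edge_sym.
  have near e e' : edge e e' -> ~~ edge e c -> ~~ edge e' c -> d != e -> edge e d.
    move=> ee ec ec'; rewrite eq_sym => ed; have := Ht e c d.
    by rewrite eq_sym (neqc _ _ ee) // cd ed (negbTE ec) (negbTE ncd); exact.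
  have ad := near _ _ ab' nac' nbc' da.
  have bd := near _ _ ba' nbc' nac' db.
  by have := bipartite_no_triangle Hb ba' ad; rewrite bd.
have embed a' b' : edge a' b' -> ~~ edge a' c -> ~~ edge b' c ->
    (forall d, d != a' -> d != b' -> d != c -> edge a' d) ->
    embeds H (path_graph 4).
  move=> ab' nac' nbc' oth.
  have eq_other x y : x != a' -> x != b' -> x != c ->
      y != a' -> y != b' -> y != c -> x = y.
    move=> xa xb xc ya yb yc; apply: contrapT => /eqP xy.
    have cx := other _ _ _ ab' nac' nbc' xa xb xc.
    have cy := other _ _ _ ab' nac' nbc' ya yb yc.
    have ax := oth _ xa xb xc; have ay := oth _ ya yb yc.
    have xa' : edge x a' by rewrite edge_sym.
    have yc' : edge y c by rewrite edge_sym.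
    have ac : a' != c by rewrite eq_sym (neqc _ _ ab').
    have := H4 x a' y c xa' ay yc' cx xy ac.
    by rewrite (negbTE nac') orbF (negbTE (bipartite_no_triangle Hb xa' ay)).
  have ca : c != a' by exact: neqc nbc'.
  have cb : c != b' by apply: neqc nac'; rewrite edge_sym.
  have nb x : x != a' -> x != b' -> x != c -> edge b' x = false.
    move=> xa xb xc; apply/negbTE.
    by apply: (bipartite_no_triangle Hb _ (oth x xa xb xc)); rewrite edge_sym.
  (* The path runs c - d - a' - b', where d is the only further vertex, if any. *)
  pose g x : nat :=
    if x == c then 0 else if x == a' then 2 else if x == b' then 3 else 1.
  have g4 x : g x < 4 by rewrite /g; do 3!case: ifP => _ //.
  have ab_ne := edge_neq ab'.
  have gP x : [\/ x = c /\ g x = 0, x = a' /\ g x = 2, x = b' /\ g x = 3 |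
      [/\ x != a', x != b' & x != c] /\ g x = 1].
    rewrite /g; case: (eqVneq x c) => [|xc]; first by constructor 1.
    case: (eqVneq x a') => [|xa]; first by constructor 2.
    by case: (eqVneq x b') => [|xb]; [constructor 3 | constructor 4].
  exists (fun x => inord (g x) : path_graph 4) => [x y /(congr1 val)|x y].
    rewrite /= !inordK //.
    by case: (gP x) => -[xE ->]; case: (gP y) => -[yE ->] // _;
      rewrite ?xE ?yE //; case: xE => *; case: yE => *; exact: eq_other.
  have S u v : edge u v = edge v u by exact: edge_sym.
  rewrite /= /path_edge !inordK //.
  case: (gP x) => -[xE ->]; case: (gP y) => -[yE ->] /=; rewrite ?xE ?yE ?edge_irrefl //.
  - by rewrite S (negbTE nac').
  - by rewrite S (negbTE nbc').
  - by case: yE => ya yb yc; rewrite (other _ _ _ ab' nac' nbc').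
  - by rewrite (negbTE nac').
  - by case: yE => ya yb yc; rewrite oth.
  - by rewrite (negbTE nbc').
  - by rewrite S ab'.
  - by case: yE => ya yb yc; rewrite nb.
  - by case: xE => ya yb yc; rewrite S (other _ _ _ ab' nac' nbc').
  - by case: xE => ya yb yc; rewrite S oth.
  - by case: xE => ya yb yc; rewrite S nb.
  - by case: xE => xa xb xc; case: yE => ya yb yc; rewrite (eq_other x y) ?edge_irrefl.
have ba : edge b a by rewrite edge_sym.
have ab_or d : d != a -> d != b -> d != c -> edge a d || edge b d.
  move=> da db dc; have cd := other _ _ _ ab nac nbc da db dc.
  by have := H2 _ _ _ _ ab cd; rewrite (negbTE nac) (negbTE nbc).
have [allb|] := EM (forall d, d != a -> d != b -> d != c -> edge b d).
  by apply: (embed b a) => // d db da; exact: allb.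
move=> nallb; apply: (embed a b) => // d da db dc; apply: contraT => nad.
case: nallb => e ea eb ec.
apply: contraT => nbe.
have bd : edge b d by have := ab_or _ da db dc; rewrite (negbTE nad).
have ae : edge a e by have := ab_or _ ea eb ec; rewrite (negbTE nbe) orbF.
have cd := other _ _ _ ab nac nbc da db dc.
have ce := other _ _ _ ab nac nbc ea eb ec.
case: Hb => p pE; move: (pE _ _ ab) (pE _ _ bd) (pE _ _ ae) (pE _ _ cd) (pE _ _ ce).
by case: (p a); case: (p b); case: (p c); case: (p d); case: (p e).
Qed.

(** * Graphs without induced P_4 and C_4 are interval graphs *)

(** Quasi-threshold (or trivially perfect) graphs: three consecutive edges [abcd]
span neither P_4 nor C_4, whether or not [a] and [d] are adjacent. *)
Definition quasi_threshold G : Prop :=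
  forall a b c d : G, edge a b -> edge b c -> edge c d ->
  a != c -> b != d -> edge a c || edge b d.

Lemma quasi_threshold_of_free G :
  ~ embeds (path_graph 4) G -> ~ embeds (cycle_graph 4) G -> quasi_threshold G.
Proof.
move=> nP nC a b c d ab bc cd ac bd; apply: contraT.
rewrite negb_or => /andP[nac nbd].
have [ad|nad] := boolP (edge a d).
  by case: nC; apply: (@C4_embeds _ a b c d) => //; rewrite edge_sym.
by case: nP; exact: (@P4_embeds _ a b c d).
Qed.

(** If [v] has maximum degree in [S], no edge leaves its closed neighbourhood
within [S]: if [uw] were one, with [u] a neighbour of [v], then every other
neighbour of [v] would be adjacent to [u], for otherwise it would continue
[w], [u], [v] to a P_4 or C_4; so [u] would have degree larger than [v].  The
induction ranges over subsets of one fixed graph, which avoids transporting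
bounds between induced subgraphs. *)
Lemma quasi_threshold_bounds G (S : {set G}) : quasi_threshold G ->
  exists l r : G -> nat, (forall x, l x <= r x) /\
    {in S &, forall x y, x != y -> edge x y = (l x <= r y) && (l y <= r x)}.
Proof.
move=> Gq; have [n] := ubnP #|S|; elim: n S => // n IH S /ltnSE Sn.
have [->|[v0 v0S]] := set_0Vmem S.
  by exists (fun=> 0), (fun=> 0); split=> // x y; rewrite inE.
pose N v := [set u in S | edge v u].
case: (@arg_maxnP _ v0 (fun u => u \in S) (fun v => #|N v|) v0S) => v vS vmax.
pose D := S :\: (v |: N v).
have Nv : v \notin N v by rewrite inE edge_irrefl andbF.
have noND u w : u \in N v -> w \in D -> ~~ edge u w.
  rewrite !inE => /andP[uS vu] /andP[]; rewrite negb_or => /andP[wv].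
  move=> /[swap] wS; rewrite wS /= => vw.
  apply/negP => uw; have := vmax u uS; rewrite /= leqNgt => /negP[].
  have sub : v |: (w |: (N v :\ u)) \subset N u.
    apply/fintype.subsetP => x; rewrite !inE => /or3P[/eqP->|/eqP->|].
    - by rewrite vS edge_sym.
    - by rewrite wS uw.
    - move=> /and3P[xu xS vx]; rewrite xS /=.
      have := Gq w u v x; rewrite edge_sym uw edge_sym vu vx wv eq_sym xu.
      by rewrite (edge_sym w) (negbTE vw); exact.
  apply: leq_trans (subset_leq_card sub).
  rewrite !cardsU1 !inE edge_irrefl !andbF !orbF eq_sym wv /=.
  rewrite (negbTE vw) !andbF /= (cardsD1 u (N v)).
  by rewrite inE uS vu.
have [lB [rB [lrB BE]]] : exists l r : G -> nat, (forall x, l x <= r x) /\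
    {in N v &, forall x y, x != y -> edge x y = (l x <= r y) && (l y <= r x)}.
  apply: IH; apply: leq_trans Sn; apply: proper_card.
  apply/fintype.properP; split; last by exists v.
  by apply/fintype.subsetP => x; rewrite inE => /andP[].
have [lD [rD [lrD DE]]] : exists l r : G -> nat, (forall x, l x <= r x) /\
    {in D &, forall x y, x != y -> edge x y = (l x <= r y) && (l y <= r x)}.
  apply: IH; apply: leq_trans Sn; apply: proper_card.
  apply/fintype.properP; split; last by exists v => //; rewrite !inE eqxx.
  by apply/fintype.subsetP => x; rewrite inE => /andP[].
(* The interval [0, M] of v covers the neighbourhood, shifted by 1; the remaining
   vertices are shifted beyond M. *)
pose M := (\max_x rB x).+1.
have rM x : rB x < M by rewrite ltnS; exact: leq_bigmax.
pose l x := if x == v then 0 else if x \in N v then (lB x).+1 else M.+1 + lD x.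
pose r x := if x == v then M else if x \in N v then (rB x).+1 else M.+1 + rD x.
exists l, r; split=> [x|].
  rewrite /l /r; case: ifP => // _; case: ifP => _; first exact: lrB.
  by rewrite leq_add2l.
have inD x : x \in S -> x != v -> x \notin N v -> x \in D.
  by move=> xS xv xN; rewrite finset.in_setD xS finset.in_setU1 (negbTE xv) /= xN.
have vE x : x \in S -> x != v ->
    edge v x = (l v <= r x) && (l x <= r v).
  move=> xS xv; rewrite /l /r eqxx (negbTE xv) leq0n inE xS /=.
  case: ifP => _; last by rewrite addSn ltnNge leq_addr.
  by rewrite (leq_ltn_trans (lrB x)).
have BDE x y : x \in N v -> y \in D -> x != v -> y != v ->
    edge x y = (l x <= r y) && (l y <= r x).
  move=> xN yD xv yv; rewrite (negbTE (noND _ _ xN yD)).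
  have yN : y \notin N v.
    by move: yD; rewrite finset.in_setD finset.in_setU1 negb_or => /andP[/andP[]].
  rewrite /l /r (negbTE xv) (negbTE yv) xN (negbTE yN); apply/esym/negP.
  move=> /andP[_]; apply/negP; rewrite -ltnNge addSn ltnS.
  exact: leq_trans (rM x) (leq_addr _ _).
move=> x y xS yS xy; have [xv|xv] := eqVneq x v.
  by rewrite xv in xy *; apply: vE; rewrite // eq_sym.
have [yv|yv] := eqVneq y v; first by rewrite yv edge_sym vE // andbC.
have [xN|xN] := boolP (x \in N v); have [yN|yN] := boolP (y \in N v).
- by rewrite /l /r (negbTE xv) (negbTE yv) xN yN !ltnS BE.
- by apply: BDE => //; exact: inD.
- by rewrite edge_sym andbC; apply: BDE => //; exact: inD.
- by rewrite /l /r (negbTE xv) (negbTE yv) (negbTE xN) (negbTE yN) !leq_add2l DE ?inD.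
Qed.

Lemma quasi_threshold_interval (R : realType) G :
  quasi_threshold G -> interval_graph R G.
Proof.
move=> /(quasi_threshold_bounds [set: G])[l [r [lr lrE]]].
by apply: interval_of_nat_bounds lr _ => x y; apply: lrE; rewrite inE.
Qed.

(** * Ramsey bound *)

(** The induction requires the homogeneous set to lie inside [S]: a vertex [v]
of [S] extends a clique found among its neighbours, or an independent set found
among its non-neighbours. *)
Lemma ramsey m n : exists N, forall G (S : {set G}), N <= #|S| ->
  (exists2 K : {set G}, m <= #|K| & {in K &, forall x y, x != y -> edge x y}) \/
  (exists2 K : {set G}, n <= #|K| & {in K &, forall x y, ~~ edge x y}).
Proof.
suff [N NP] : exists N, forall G (S : {set G}), N <= #|S| ->
  (exists K : {set G}, [/\ K \subset S, m <= #|K| &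
     {in K &, forall x y, x != y -> edge x y}]) \/
  (exists K : {set G}, [/\ K \subset S, n <= #|K| &
     {in K &, forall x y, ~~ edge x y}]).
  exists N => G S /NP[[K [_ Km KE]]|[K [_ Kn KE]]]; first by left; exists K.
  by right; exists K.
have [k] := ubnP (m + n); elim: k m n => // k IH [|m] [|n] /ltnSE mnk.
1-3: by exists 0 => G S _; (left + right); exists finset.set0;
  rewrite finset.sub0set cards0; split=> // x y; rewrite inE.
have [|N1 P1] := IH m n.+1; first by rewrite -addSn.
have [|N2 P2] := IH m.+1 n; first by rewrite -addnS.
exists (N1 + N2).+1 => G S SN.
have [v vS] : exists v, v \in S.
  by apply/set0Pn; rewrite -card_gt0 (leq_trans _ SN).
pose A := [set u in S :\ v | edge v u]; pose B := [set u in S :\ v | ~~ edge v u].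
have sA : A \subset S by apply/fintype.subsetP => x; rewrite !inE => /andP[/andP[]].
have sB : B \subset S by apply/fintype.subsetP => x; rewrite !inE => /andP[/andP[]].
have AB : #|A| + #|B| = #|S :\ v|.
  rewrite -(cardsID [set u | edge v u] (S :\ v)); congr (_ + _);
    by apply: eq_card => x; rewrite !inE // andbC.
have vA x : x \in A -> edge v x by rewrite inE => /andP[].
have vB x : x \in B -> ~~ edge v x by rewrite inE => /andP[].
have nvA : v \notin A by rewrite !inE eqxx.
have nvB : v \notin B by rewrite !inE eqxx.
have [N1A|AN1] := leqP N1 #|A|.
  have [[K [KA Km KE]]|[K [KA Kn KE]]] := P1 _ _ N1A; last first.
    by right; exists K; rewrite (fintype.subset_trans KA sA).
  have vK : v \notin K by apply: contra nvA; exact: (fintype.subsetP KA).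
  left; exists (v |: K); split.
  - by rewrite finset.subUset finset.sub1set vS (fintype.subset_trans KA sA).
  - by rewrite cardsU1 vK.
  - move=> x y /finset.setU1P[->|xK] /finset.setU1P[->|yK] xy.
    + by rewrite eqxx in xy.
    + exact/vA/(fintype.subsetP KA).
    + by rewrite edge_sym; exact/vA/(fintype.subsetP KA).
    + exact: KE.
have N2B : N2 <= #|B|.
  move: SN; rewrite (cardsD1 v S) vS ltnS -AB => SN.
  by rewrite -(leq_add2l N1) (leq_trans SN) // leq_add2r ltnW.
have [[K [KB Km KE]]|[K [KB Kn KE]]] := P2 _ _ N2B.
  by left; exists K; rewrite (fintype.subset_trans KB sB).
have vK : v \notin K by apply: contra nvB; exact: (fintype.subsetP KB).
right; exists (v |: K); split.
- by rewrite finset.subUset finset.sub1set vS (fintype.subset_trans KB sB).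
- by rewrite cardsU1 vK.
- move=> x y /finset.setU1P[->|xK] /finset.setU1P[->|yK].
  + by rewrite edge_irrefl.
  + exact/vB/(fintype.subsetP KB).
  + by rewrite edge_sym; exact/vB/(fintype.subsetP KB).
  + exact: KE.
Qed.

(** Complete graphs ([e = true]) and edgeless graphs ([e = false]) embed by any
injection. *)
Lemma embeds_of_constant_edges H G (K : {set G}) (e : bool) : #|H| <= #|K| ->
  (forall x y : H, x != y -> edge x y = e) ->
  {in K &, forall x y, x != y -> edge x y = e} -> embeds H G.
Proof.
move=> HK He Ke.
pose f (x : H) : G := enum_val (widen_ord HK (enum_rank x)).
have fI : injective f.
  by move=> x y /enum_val_inj/(congr1 val)/= /val_inj/enum_rank_inj.
exists f => // x y; have [->|xy] := eqVneq x y; first by rewrite !edge_irrefl.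
by rewrite He // Ke ?enum_valP // (inj_eq fI).
Qed.

Lemma free_complete_edgeless_bound A B :
  complete_graph A -> edgeless_graph B ->
  exists N, forall G, ~ embeds A G -> ~ embeds B G -> #|G| < N.
Proof.
move=> Ac Be; have [N NP] := ramsey #|A| #|B|.
exists N => G nA nB; rewrite ltnNge -cardsT; apply/negP => /NP.
case=> -[K Kc KE].
- by apply: nA; exact: (embeds_of_constant_edges (e := true) Kc).
- apply: nB; apply: (embeds_of_constant_edges (e := false) Kc) => [x y _|x y xK yK _].
    exact/negbTE/Be.
  exact/negbTE/KE.
Qed.

(** * Families that stay far from interval graphs *)

Section Rows.
Variables (T : finType) (E : bool -> rel T).
Hypotheses (E_sym : forall b, symmetric (E b)) (E_irrefl : irreflexive (E true)).

(** Adjacency depends on the two columns, and on the two rows only through their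
equality.  Hence any [k] rows induce the same graph, and deleting few vertices
leaves many rows untouched. *)
Definition row_edge n : rel ('I_n * T) := fun x y => E (x.1 == y.1) x.2 y.2.

Lemma row_edge_sym n : symmetric (@row_edge n).
Proof. by move=> x y; rewrite /row_edge eq_sym E_sym. Qed.

Lemma row_edge_irrefl n : irreflexive (@row_edge n).
Proof. by move=> x; rewrite /row_edge eqxx E_irrefl. Qed.

Definition rows n : sgraph := SGraph (@row_edge_sym n) (@row_edge_irrefl n).

Lemma rows_delete n (S : {set rows n}) k :
  #|S| + k <= n -> embeds (rows k) (delete_vertices S).
Proof.
move=> Sk; pose U := ~: [set x.1 | x in S].
have kU : k <= #|U|.
  rewrite cardsCs finset.setCK card_ord leq_subRL.
    by apply: leq_trans Sk; rewrite leq_add2r leq_imset_card.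
  by rewrite (leq_trans _ Sk) // (leq_trans (leq_imset_card _ _)) // leq_addr.
pose u (i : 'I_k) : 'I_n := enum_val (widen_ord kU i).
have uI : injective u by move=> i j /enum_val_inj/(congr1 val)/= /val_inj.
have uS (x : rows k) : (u x.1, x.2) \in ~: S.
  rewrite inE; apply: contraL (enum_valP (widen_ord kU x.1)) => xS.
  by rewrite inE negbK; apply/imsetP; exists (u x.1, x.2).
exists (fun x => exist (fun y => y \in ~: S) _ (uS x)) => [[i s] [j t] [/uI /= -> ->] //|].
by move=> x y; rewrite /= /induced_edge /= /row_edge /= (inj_eq uI).
Qed.

End Rows.

Definition far_from_interval (R : realType) (F : nat -> sgraph) : Prop :=
  forall c, exists n, forall S : {set F n}, #|S| <= c ->
  ~ interval_graph R (delete_vertices S).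

Lemma rows_far (R : realType) (T : finType) (E : bool -> rel T)
    (E_sym : forall b, symmetric (E b)) (E_irrefl : irreflexive (E true)) k :
  ~ interval_graph R (rows E_sym E_irrefl k) ->
  far_from_interval R (rows E_sym E_irrefl).
Proof.
move=> nint c; exists (c + k) => S Sc Sint; apply: nint.
by apply: interval_embeds Sint; apply: rows_delete; rewrite leq_add2r.
Qed.

(** A graph of the family containing neither [A] nor [B] would belong to the
class. *)
Lemma bounded_meets_far (R : realType) A B F :
  bounded_apex_interval R (free_of (graph_pair A B)) ->
  far_from_interval R F -> exists n, embeds A (F n) \/ embeds B (F n).
Proof.
move=> [c Cc] /(_ c)[n nF]; exists n; apply: contrapT => /not_orP[nA nB].
have [|S Sc] := Cc (F n); first exact/free_pairE.
exact: nF.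
Qed.

Definition disjoint_cycles_edge r (b : bool) : rel 'I_r := fun s t => b && cycle_edge s t.
Lemma disjoint_cycles_sym r b : symmetric (@disjoint_cycles_edge r b).
Proof. by move=> s t; rewrite /disjoint_cycles_edge cycle_edge_sym. Qed.
Lemma disjoint_cycles_irrefl r : irreflexive (@disjoint_cycles_edge r true).
Proof. by move=> s; rewrite /disjoint_cycles_edge cycle_edge_irrefl. Qed.
Definition disjoint_cycles r := rows (@disjoint_cycles_sym r) (@disjoint_cycles_irrefl r).

Definition biclique_edge (b : bool) : rel bool := fun s t => s != t.
Lemma biclique_sym b : symmetric (biclique_edge b).
Proof. by case; case. Qed.
Lemma biclique_irrefl : irreflexive (biclique_edge true).
Proof. by case. Qed.
(** The columns are the two sides of K_{n,n}. *)
Definition biclique := rows biclique_sym biclique_irrefl.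

Definition cocktail_party_edge (b : bool) : rel bool := fun s t => ~~ b.
Lemma cocktail_party_sym b : symmetric (cocktail_party_edge b).
Proof. by []. Qed.
Lemma cocktail_party_irrefl : irreflexive (cocktail_party_edge true).
Proof. by []. Qed.
(** K_{2,...,2}: rows are the parts. *)
Definition cocktail_party := rows cocktail_party_sym cocktail_party_irrefl.

Definition clique_prism_edge (b : bool) : rel bool := fun s t => b (+) (s == t).
Lemma clique_prism_sym b : symmetric (clique_prism_edge b).
Proof. by case: b; case; case. Qed.
Lemma clique_prism_irrefl : irreflexive (clique_prism_edge true).
Proof. by case. Qed.
(** Two cliques, the columns, joined by a perfect matching, the rows. *)
Definition clique_prism := rows clique_prism_sym clique_prism_irrefl.

Definition blown_C5_edge (b : bool) : rel 'I_5 :=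
  fun s t => ~~ b && (s == t) || cycle_edge s t.
Lemma blown_C5_sym b : symmetric (blown_C5_edge b).
Proof. by move=> s t; rewrite /blown_C5_edge cycle_edge_sym eq_sym. Qed.
Lemma blown_C5_irrefl : irreflexive (blown_C5_edge true).
Proof. by move=> s; rewrite /blown_C5_edge cycle_edge_irrefl. Qed.
(** C_5 with each vertex replaced by a clique, its column. *)
Definition blown_C5 := rows blown_C5_sym blown_C5_irrefl.

Definition thick_spider_edge (b : bool) : rel bool := fun s t => ~~ b && (s || t).
Lemma thick_spider_sym b : symmetric (thick_spider_edge b).
Proof. by move=> s t; rewrite /thick_spider_edge orbC. Qed.
Lemma thick_spider_irrefl : irreflexive (thick_spider_edge true).
Proof. by []. Qed.
(** The column [true] is a clique, the column [false] is independent, and across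
columns exactly the vertices of the same row are non-adjacent.  Three rows form
the 3-sun, whose independent vertices are an asteroidal triple. *)
Definition thick_spider := rows thick_spider_sym thick_spider_irrefl.

Section Far.
Variable R : realType.
Let i0 : 'I_3 := @Ordinal 3 0 isT.
Let i1 : 'I_3 := @Ordinal 3 1 isT.
Let i2 : 'I_3 := @Ordinal 3 2 isT.

Lemma biclique_far : far_from_interval R biclique.
Proof.
apply: (@rows_far _ _ _ _ _ 3) => /interval_C4_free.
by move=> /(_ (i0, false) (i0, true) (i1, false) (i1, true) isT isT isT isT isT isT).
Qed.

Lemma cocktail_party_far : far_from_interval R cocktail_party.
Proof.
apply: (@rows_far _ _ _ _ _ 3) => /interval_C4_free.
by move=> /(_ (i0, false) (i1, false) (i0, true) (i1, true) isT isT isT isT isT isT).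
Qed.

Lemma clique_prism_far : far_from_interval R clique_prism.
Proof.
apply: (@rows_far _ _ _ _ _ 3) => /interval_C4_free.
by move=> /(_ (i0, false) (i0, true) (i1, true) (i1, false) isT isT isT isT isT isT).
Qed.

Lemma blown_C5_far : far_from_interval R blown_C5.
Proof.
apply: (@rows_far _ _ _ _ _ 3) => Gint; apply: (@interval_no_C5 R).
apply: interval_embeds Gint; exists (pair i0) => [s t []//|s t].
by rewrite /= /row_edge /= /blown_C5_edge eqxx.
Qed.

Lemma thick_spider_far : far_from_interval R thick_spider.
Proof.
apply: (@rows_far _ _ _ _ _ 3).
exact: (@interval_no_asteroidal_triple R (rows thick_spider_sym thick_spider_irrefl 3)
  (i0, false) (i1, false) (i2, false) (i2, true) (i0, true) (i1, true)).
Qed.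

Lemma disjoint_C6_far : far_from_interval R (disjoint_cycles 6).
Proof.
apply: (@rows_far _ _ _ _ _ 3).
pose v (s : 'I_6) : disjoint_cycles 6 3 := (i0, s).
exact: (@interval_no_asteroidal_triple R (disjoint_cycles 6 3)
  (v (@Ordinal 6 0 isT)) (v (@Ordinal 6 2 isT)) (v (@Ordinal 6 4 isT))
  (v (@Ordinal 6 1 isT)) (v (@Ordinal 6 3 isT)) (v (@Ordinal 6 5 isT))).
Qed.

End Far.

Lemma biclique_bipartite n : bipartite (biclique n).
Proof. by exists snd. Qed.

Lemma biclique_coP3_free n : coP3_free (biclique n).
Proof. by move=> [i []] [j []] [k []]. Qed.

Lemma cocktail_party_coP3_free n : coP3_free (cocktail_party n).
Proof.
move=> [i s] [j t] [k u]; rewrite /= /row_edge /cocktail_party_edge /=.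
by have [->|//] := eqVneq i k; rewrite eq_sym => ->.
Qed.

Lemma cocktail_party_co_triangle_free n : co_triangle_free (cocktail_party n).
Proof.
move=> [i s] [j t] [k u]; rewrite -!pair_eqE /= /row_edge /= /cocktail_party_edge /pair_eq /=.
have [_|_] //= := eqVneq i j; have [_|_] //= := eqVneq i k; have [_|_] //= := eqVneq j k.
by case: s; case: t; case: u.
Qed.

Lemma clique_prism_co_triangle_free n : co_triangle_free (clique_prism n).
Proof.
move=> [i s] [j t] [k u]; rewrite -!pair_eqE /= /row_edge /= /clique_prism_edge /pair_eq /=.
have [ij|ij] //= := eqVneq i j; have [jk|jk] //= := eqVneq j k;
  have [ik|ik] //= := eqVneq i k; by case: s; case: t; case: u.
Qed.

Lemma clique_prism_diamond_free n : diamond_free (clique_prism n).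
Proof.
move=> [i s] [j t] [k u] [l w]; rewrite -pair_eqE.
rewrite /= /row_edge /= /clique_prism_edge /pair_eq /=.
have [ij|ij] //= := eqVneq i j; have [ik|ik] //= := eqVneq i k;
 have [jk|jk] //= := eqVneq j k; have [il|il] //= := eqVneq i l;
 have [jl|jl] //= := eqVneq j l; have [kl|kl] //= := eqVneq k l;
 subst; first [by case: s; case: t; case: u; case: w
  | by match goal with H : is_true (?x != ?x) |- _ => case/eqP: H end].
Qed.

Lemma blown_C5_edgeE n (x y : blown_C5 n) :
  edge x y = (x != y) && ((x.2 == y.2) || cycle_edge x.2 y.2).
Proof.
case: x y => [i s] [j t]; rewrite -pair_eqE /= /row_edge /= /blown_C5_edge /pair_eq /=.
have [->|] /= := eqVneq s t; last by rewrite !andbF.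
by rewrite cycle_edge_irrefl orbF !andbT.
Qed.

Lemma blown_C5_co_triangle_free n : co_triangle_free (blown_C5 n).
Proof.
move=> x y z xy yz xz; rewrite !blown_C5_edgeE xy yz xz /=.
by move: x.2 y.2 z.2 => [[|[|[|[|[|//]]]]] ?] [[|[|[|[|[|//]]]]] ?] [[|[|[|[|[|//]]]]] ?].
Qed.

Lemma blown_C5_C4_free n : C4_free (blown_C5 n).
Proof.
move=> a b c d; rewrite !blown_C5_edgeE.
move=> /andP[_ ab] /andP[_ bc] /andP[_ cd] /andP[_ da] -> -> /=.
move: a.2 b.2 ab c.2 bc d.2 cd da => [[|[|[|[|[|//]]]]] ?] [[|[|[|[|[|//]]]]] ?] //= _
  [[|[|[|[|[|//]]]]] ?] //= _ [[|[|[|[|[|//]]]]] ?] //=.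
Qed.

Lemma thick_spider_C4_free n : C4_free (thick_spider n).
Proof.
move=> [i s] [j t] [k u] [l w]; rewrite -!pair_eqE.
rewrite /= /row_edge /= /thick_spider_edge /pair_eq /=.
by have [ij|ij] //= := eqVneq i k; have [jk|jk] //= := eqVneq j l;
  case: s; case: t; case: u; case: w; rewrite /= ?andbF ?orbT.
Qed.

Lemma thick_spider_two_K2_free n : two_K2_free (thick_spider n).
Proof.
move=> [i s] [j t] [k u] [l w] /= /andP[/= ij st] /andP[/= kl uw].
rewrite /row_edge /= /thick_spider_edge.
have [ik|ik] //= := eqVneq i k; have [il|il] //= := eqVneq i l;
 have [jk|jk] //= := eqVneq j k; have [jl|jl] //= := eqVneq j l;
 subst; first [by move: st uw; case: s; case: t; case: u; case: w
  | by match goal with H : is_true (?x != ?x) |- _ => case/eqP: H end].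
Qed.

Lemma disjoint_C6_bipartite n : bipartite (disjoint_cycles 6 n).
Proof.
exists (fun x : 'I_n * 'I_6 => odd x.2) => -[i s] [j t] /andP[_].
by move: s t => [[|[|[|[|[|[|//]]]]]] ?] [[|[|[|[|[|[|//]]]]]] ?].
Qed.

Lemma disjoint_cycles_row r n (x y : disjoint_cycles r n) :
  edge x y -> x.1 = y.1 /\ cycle_edge x.2 y.2.
Proof. by move=> /andP[/eqP]. Qed.

Lemma disjoint_C6_claw_free n : claw_free (disjoint_cycles 6 n).
Proof.
move=> [l c] [i x] [j y] [k z] /disjoint_cycles_row[/= <- cx].
move=> /disjoint_cycles_row[/= <- cy] /disjoint_cycles_row[/= <- cz].
rewrite -!pair_eqE /pair_eq /= eqxx /=.
by move: c x cx y cy z cz => [[|[|[|[|[|[|//]]]]]] ?] [[|[|[|[|[|[|//]]]]]] ?] //= _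
  [[|[|[|[|[|[|//]]]]]] ?] //= _ [[|[|[|[|[|[|//]]]]]] ?].
Qed.

Lemma disjoint_C6_C4_free n : C4_free (disjoint_cycles 6 n).
Proof.
move=> [l a] [i b] [j c] [k d] /disjoint_cycles_row[/= <- ab].
move=> /disjoint_cycles_row[/= <- bc] /disjoint_cycles_row[/= <- cd].
move=> /disjoint_cycles_row[/= _ da].
rewrite -!pair_eqE /pair_eq /= eqxx /=.
by move: a b ab c bc d cd da => [[|[|[|[|[|[|//]]]]]] ?] [[|[|[|[|[|[|//]]]]]] ?] //= _
  [[|[|[|[|[|[|//]]]]]] ?] //= _ [[|[|[|[|[|[|//]]]]]] ?].
Qed.

(** * The dichotomy *)

Lemma C4_not_in_C4_free A F : isomorphic A (cycle_graph 4) -> C4_free F -> ~ embeds A F.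
Proof.
move=> /isomorphic_sym/isomorphic_embeds CA F4 AF; apply: cycle4_not_C4_free.
exact: C4_free_embeds (embeds_trans CA AF) F4.
Qed.

(** The role of 6-cycles is to select the graph [A] that is bipartite without C_4
and claw; every further family either admits [A], restricting it more, or must
admit [B]. *)
Lemma bounded_dichotomy (R : realType) A B n :
  bounded_apex_interval R (free_of (graph_pair A B)) ->
  embeds A (disjoint_cycles 6 n) ->
  [\/ embeds A (path_graph 3), embeds B (path_graph 3),
      embeds A (path_graph 4) /\ isomorphic B (cycle_graph 4) |
      complete_graph B /\ edgeless_graph A].
Proof.
move=> Cb AC6.
have Abip := bipartite_embeds AC6 (@disjoint_C6_bipartite n).
have Aclaw := claw_free_embeds AC6 (@disjoint_C6_claw_free n).
have AC4 := C4_free_embeds AC6 (@disjoint_C6_C4_free n).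
have [n1 bic] := bounded_meets_far Cb (@biclique_far R).
have [n2 coc] := bounded_meets_far Cb (@cocktail_party_far R).
have [n3 pri] := bounded_meets_far Cb (@clique_prism_far R).
have [n4 bC5] := bounded_meets_far Cb (@blown_C5_far R).
have [n5 spi] := bounded_meets_far Cb (@thick_spider_far R).
have [At|nAt] := EM (co_triangle_free A); last first.
  have hits F : co_triangle_free F -> embeds A F \/ embeds B F -> embeds B F.
    by move=> Ft [AF|//]; case: nAt; exact: co_triangle_free_embeds AF Ft.
  have Bcoc := hits _ (@cocktail_party_co_triangle_free n2) coc.
  have Bpri := hits _ (@clique_prism_co_triangle_free n3) pri.
  have BbC5 := hits _ (@blown_C5_co_triangle_free n4) bC5.
  have Bm := coP3_free_embeds Bcoc (@cocktail_party_coP3_free n2).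
  have Bt := co_triangle_free_embeds Bcoc (@cocktail_party_co_triangle_free n2).
  have Bd := diamond_free_embeds Bpri (@clique_prism_diamond_free n3).
  have [Bc|BP3|BC4] := complete_P3_or_C4 Bm Bt Bd; first last.
  - by case: (C4_not_in_C4_free BC4 (@blown_C5_C4_free n4)).
  - by constructor 2.
  case: bic => bic.
    constructor 4; split=> //; apply: claw_free_edgeless => //.
    exact: coP3_free_embeds bic (@biclique_coP3_free n1).
  constructor 2; apply: complete_bipartite_embeds_P3 => //.
  exact: bipartite_embeds bic (@biclique_bipartite n1).
have [Am|nAm] := EM (coP3_free A).
  have [Ac|AP3|AiC4] := complete_P3_or_C4 Am At (bipartite_diamond_free Abip).
  - by constructor 1; exact: complete_bipartite_embeds_P3.
  - by constructor 1.
  - by case: (C4_not_in_C4_free AiC4 AC4 (embeds_refl A)).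
have hits F : coP3_free F -> embeds A F \/ embeds B F -> embeds B F.
  by move=> Fm [AF|//]; case: nAm; exact: coP3_free_embeds AF Fm.
have Bbic := hits _ (@biclique_coP3_free n1) bic.
have Bcoc := hits _ (@cocktail_party_coP3_free n2) coc.
have Bbip := bipartite_embeds Bbic (@biclique_bipartite n1).
have Bm := coP3_free_embeds Bcoc (@cocktail_party_coP3_free n2).
have Bt := co_triangle_free_embeds Bcoc (@cocktail_party_co_triangle_free n2).
have [Bc|BP3|BC4] := complete_P3_or_C4 Bm Bt (bipartite_diamond_free Bbip).
- by constructor 2; exact: complete_bipartite_embeds_P3.
- by constructor 2.
case: spi => spi; last by case: (C4_not_in_C4_free BC4 (@thick_spider_C4_free n5) spi).
constructor 3; split=> //; apply: embeds_P4 => //.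
exact: two_K2_free_embeds spi (@thick_spider_two_K2_free n5).
Qed.

Lemma graph_pairC A B : free_of (graph_pair A B) = free_of (graph_pair B A).
Proof.
by rewrite predeqE => G; split=> /free_pairE[]; rewrite free_pairE.
Qed.

(** The alternative [embeds A (cycle_graph 4)] serves induced subgraphs of P_3,
which exclude both P_4 and C_4 by themselves. *)
Lemma free_P4_C4_interval (R : realType) A B G :
  embeds A (path_graph 4) -> embeds A (cycle_graph 4) \/ embeds B (cycle_graph 4) ->
  free_of (graph_pair A B) G -> interval_graph R G.
Proof.
move=> AP ABC /free_pairE[nA nB]; apply/quasi_threshold_interval.
apply: quasi_threshold_of_free => [PG|CG]; first exact/nA/(embeds_trans AP).
by case: ABC => [A4|B4]; [exact/nA/(embeds_trans A4)|exact/nB/(embeds_trans B4)].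
Qed.

Lemma apex_interval_0 (R : realType) A B :
  (forall G, free_of (graph_pair A B) G -> interval_graph R G) ->
  apex_interval R 0 (free_of (graph_pair A B)).
Proof.
move=> intv G /free_pairE[nA nB]; exists finset.set0; first by rewrite cards0.
apply/intv/free_pairE; have DG := induced_embeds (~: (finset.set0 : {set G})).
by split=> /embeds_trans/(_ DG).
Qed.

Lemma free_complete_edgeless_bounded (R : realType) A B :
  complete_graph A -> edgeless_graph B ->
  bounded_apex_interval R (free_of (graph_pair A B)).
Proof.
move=> Ac Be; have [N NP] := free_complete_edgeless_bound Ac Be.
exists N => G /free_pairE[nA nB]; exists [set: G].
  by rewrite cardsT ltnW // NP.
by apply: interval_no_vertices; rewrite card_sig eq_card0 // => x; rewrite !inE.
Qed.

Theorem theorem7p2 (R : realType) (H1 H2 : sgraph) :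
  let C := free_of (graph_pair H1 H2) in
  let case1 (A B : sgraph) := induced_subgraph A (path_graph 3) in
  let case2 (A B : sgraph) :=
    induced_subgraph A (path_graph 4) /\ isomorphic B (cycle_graph 4) in
  let case3 (A B : sgraph) := complete_graph A /\ edgeless_graph B in
  let up_to_switch (P : sgraph -> sgraph -> Prop) := P H1 H2 \/ P H2 H1 in
  (bounded_apex_interval R C <->
     up_to_switch (fun A B => case1 A B \/ case2 A B \/ case3 A B)) /\
  (up_to_switch case2 ->
     apex_interval R 0 C /\ forall G, C G -> interval_graph R G).
Proof.
move=> C case1 case2 case3 up_to_switch.
have necessary A B n : bounded_apex_interval R (free_of (graph_pair A B)) ->
    embeds A (disjoint_cycles 6 n) ->
    (case1 A B \/ case2 A B \/ case3 A B) \/ (case1 B A \/ case2 B A \/ case3 B A).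
  move=> Cb /(bounded_dichotomy Cb)
    [/induced_subgraphE AP3|/induced_subgraphE BP3|[/induced_subgraphE AP4 BC4]|BA].
  - by left; left.
  - by right; left.
  - by left; right; left.
  - by right; right; right.
have case2_interval A B : case2 A B ->
    forall G, free_of (graph_pair A B) G -> interval_graph R G.
  move=> [/induced_subgraphE AP /isomorphic_embeds BC] G.
  by apply: free_P4_C4_interval => //; right.
have sufficient A B : case1 A B \/ case2 A B \/ case3 A B ->
    bounded_apex_interval R (free_of (graph_pair A B)).
  move=> [/induced_subgraphE AP3|[AB|[Ac Be]]].
  - exists 0; apply: apex_interval_0 => G; apply: free_P4_C4_interval.
      exact: embeds_trans AP3 P3_embeds_P4.
    by left; exact: embeds_trans AP3 P3_embeds_C4.
  - by exists 0; apply: apex_interval_0; exact: case2_interval.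
  - exact: free_complete_edgeless_bounded.
split; first split.
- move=> Cb; have [n [H1n|H2n]] := bounded_meets_far Cb (@disjoint_C6_far R).
    exact: necessary H1n.
  by apply/or_comm; apply: necessary H2n; rewrite graph_pairC.
- by case=> [/sufficient//|/sufficient]; rewrite graph_pairC.
- move=> sw; have intv G : C G -> interval_graph R G.
    by case: sw => /case2_interval; [exact | rewrite graph_pairC; exact].
  by split=> //; exact: apex_interval_0.
Qed.
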